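(* Suppose that $f$ is smooth with $\nabla f$ Lipschitz continuous with constant $L$, and that $h$ is convex (possibly nonsmooth) and Lipschitz continuous with constant $L_h$. Let $\{X_k\}$ be generated by the ManPQN algorithm described in the context, where for all $k$ the operator $\mathcal{B}_k$ satisfies $\kappa_1\|V\|^2\le\|V\|_{\mathcal{B}_k}^2\le\kappa_2\|V\|^2$ for all $V\in {\rm T}_{X_k}\mathcal{M}$. Let $F^*=\min_{X\in\mathcal{M}}F(X)$ and let $\epsilon>0$. Then the algorithm finds an $\epsilon$-stationary point in at most $$N=(m+1)\left\lceil\frac{2(F(X_0)-F^* )}{\sigma\kappa_1\gamma\overline{\alpha}\epsilon^2}\right\rceil$$ iterations; that is, there is an index $0\le k\le N$ with $\|V_k\|\le\epsilon$.
   Context: Let $\mathcal{M}={\rm St}(n,r)=\{X\in\mathbb{R}^{n\times r}: X^\top X=I_r\}$ with the Riemannian metric $\langle\xi,\zeta\rangle={\rm tr}(\xi^\top\zeta)$ and $\|\cdot\|$ the induced (Frobenius) norm. Its tangent space is ${\rm T}_X\mathcal{M}=\{V\in\mathbb{R}^{n\times r}: V^\top X+X^\top V=0\}$. Let $f,h:\mathbb{R}^{n\times r}\to\mathbb{R}$ and $F=f+h$; $\nabla f$ is the Euclidean gradient. Let $\mathbf{R}$ be a retraction on $\mathcal{M}$: a smooth map from the tangent bundle to $\mathcal{M}$ whose restriction $\mathbf{R}_X$ to ${\rm T}_X\mathcal{M}$ satisfies $\mathbf{R}_X(0_X)=X$ and ${\rm D}\mathbf{R}_X(0_X)={\bf id}$.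 Since $\mathcal{M}$ is compact, there are (known result) constants $M_1,M_2>0$, fixed once and for all, with $\|\mathbf{R}_X(\xi)-X\|\le M_1\|\xi\|$ and $\|\mathbf{R}_X(\xi)-X-\xi\|\le M_2\|\xi\|^2$ for all $X\in\mathcal{M}$, $\xi\in{\rm T}_X\mathcal{M}$. Constants: $\varrho=\sup_{X\in\mathcal{M}}\|\nabla f(X)\|$; for parameters $\delta>0$ and a positive integer $p$, with $\upsilon=(4L+4\varrho+5\delta)/\delta$, $$\kappa_1=\Big(\frac{\upsilon^{2p}-1}{\upsilon^2-1}\cdot\frac4\delta+\frac{\upsilon^{2p}}{\delta}\Big)^{-1},\qquad \kappa_2=\delta+\frac{4(L+\varrho+\delta)^2}{\delta}p,$$ and $$\overline{\alpha}=\min\Big\{1,\frac{(2-\sigma)\kappa_1}{2(\varrho M_2+\frac12LM_1^2+L_hM_2)}\Big\}.$$ ManPQN algorithm: parameters $\gamma,\sigma\in(0,1)$, integer $m>0$, initial point $X_0\in\mathcal{M}$. For $k=0,1,2,\dots$: given a symmetric positive definite linear operator $\mathcal{B}_k$ on ${\rm T}_{X_k}\mathcal{M}$, with $\|V\|_{\mathcal{B}_k}^2=\langle V,\mathcal{B}_k[V]\rangle$, let $$V_k=\arg\min_{V\in{\rm T}_{X_k}\mathcal{M}}\ \langle\nabla f(X_k),V\rangle+\tfrac12\|V\|_{\mathcal{B}_k}^2+h(X_k+V);$$ set $\alpha_k=\gamma^{N_k}$ where $N_k\ge0$ is the smallest integer such that $$F(\mathbf{R}_{X_k}(\alpha_kV_k))\le\max_{\max\{0,k-m\}\le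 j\le k}F(X_j)-\tfrac12\sigma\alpha_k\|V_k\|_{\mathcal{B}_k}^2;$$ set $X_{k+1}=\mathbf{R}_{X_k}(\alpha_kV_k)$. The iterate $X_k$ is called an $\epsilon$-stationary point if $\|V_k\|\le\epsilon$. *)

(* Defs.v *)
From HB Require Import structures.
From mathcomp Require Import all_boot all_order all_algebra.
From mathcomp Require Import all_classical all_reals all_analysis.
Set Implicit Arguments.
Unset Strict Implicit.
Unset Printing Implicit Defensive.
Import Order.TTheory GRing.Theory Num.Theory.
Import numFieldNormedType.Exports.
Local Open Scope classical_set_scope.
Local Open Scope ring_scope.

(* The library norm `|A| of a matrix is the max norm; it is used below only
   through the topology.  All metric quantities use the Frobenius norm. *)
Definition fdot (R : realType) (n r : nat) (A B : 'M[R]_(n, r)) : R :=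
  \tr (A^T *m B).

Definition fnorm (R : realType) (n r : nat) (A : 'M[R]_(n, r)) : R :=
  Num.sqrt (fdot A A).

Definition stiefel (R : realType) (n r : nat) : set 'M[R]_(n, r) :=
  [set X | X^T *m X = 1%:M].

Definition tangent (R : realType) (n r : nat) (X : 'M[R]_(n, r)) :
    set 'M[R]_(n, r) :=
  [set V | V^T *m X + X^T *m V = 0].

Definition tangent_bundle (R : realType) (n r : nat) :
    set ('M[R]_(n, r) * 'M[R]_(n, r)) :=
  [set z | stiefel z.1 /\ tangent z.1 z.2].

(* In finite dimension, g is C^(k+1) on an open U iff it is differentiable on U
   and x |-> 'd g x v is C^k on U for every fixed direction v. *)
Fixpoint is_Ck (R : realType) (V W : normedModType R) (k : nat) (U : set V)
    (g : V -> W) : Prop :=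
  match k with
  | 0 => forall x, U x -> {for x, continuous g}
  | k'.+1 => (forall x, U x -> differentiable g x) /\
             (forall v, is_Ck k' U (fun x => 'd g x v))
  end.

(* Smoothness on an embedded submanifold S (values of g outside S are
   irrelevant): locally, g is the restriction of a C^oo map on an open set. *)
Definition smooth_on_submanifold (R : realType) (V W : normedModType R)
    (S : set V) (g : V -> W) : Prop :=
  forall x, S x -> exists (U : set V) (G : V -> W),
    [/\ open U, U x, (forall k, is_Ck k U G) &
        forall y, U y -> S y -> G y = g y].

(* Rt X xi is meaningful only for (X, xi) in the tangent bundle.  The last
   clause is D R_X(0_X)[V] = V for V in T_X M; it evaluates Rt X only on the
   line spanned by V. *)
Definition is_retraction (R : realType) (n r : nat)
    (Rt : 'M[R]_(n, r) -> 'M[R]_(n, r) -> 'M[R]_(n, r)) : Prop :=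
  [/\ forall X xi, stiefel X -> tangent X xi -> stiefel (Rt X xi),
      smooth_on_submanifold (@tangent_bundle R n r) (fun z => Rt z.1 z.2),
      forall X, stiefel X -> Rt X 0 = X &
      forall X V, stiefel X -> tangent X V ->
        is_derive (0 : 'M[R]_(n, r)) V (Rt X) V].

(* For f differentiable at X this is the vector representing 'd f X for fdot. *)
Definition gradient (R : realType) (n r : nat) (f : 'M[R]_(n, r) -> R)
    (X : 'M[R]_(n, r)) : 'M[R]_(n, r) :=
  \matrix_(i, j) 'd f X (delta_mx i j).

Definition sup_gradient (R : realType) (n r : nat) (f : 'M[R]_(n, r) -> R) : R :=
  sup [set fnorm (gradient f X) | X in @stiefel R n r].

Definition is_min_on (R : realType) (T : Type) (S : set T) (F : T -> R) (c : R) :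
    Prop :=
  (exists2 x, S x & F x = c) /\ (forall x, S x -> c <= F x).

Definition is_argmin_on (R : realType) (T : Type) (S : set T) (F : T -> R)
    (x : T) : Prop :=
  S x /\ (forall y, S y -> F x <= F y).

(* Only the restriction of B to the subspace T is constrained. *)
Definition spd_operator_on (R : realType) (n r : nat) (T : set 'M[R]_(n, r))
    (B : 'M[R]_(n, r) -> 'M[R]_(n, r)) : Prop :=
  [/\ forall V, T V -> T (B V),
      forall (a : R) U V, T U -> T V -> B (a *: U + V) = a *: B U + B V,
      forall U V, T U -> T V -> fdot U (B V) = fdot (B U) V &
      forall V, T V -> V != 0 -> 0 < fdot V (B V)].

Section constants.
Context {R : realType}.
Variables (L rho delta : R) (p : nat).

Definition upsilon : R := (4 * L + 4 * rho + 5 * delta) / delta.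

Definition kappa1 : R :=
  ((upsilon ^+ (2 * p) - 1) / (upsilon ^+ 2 - 1) * (4 / delta)
   + upsilon ^+ (2 * p) / delta)^-1.

Definition kappa2 : R := delta + 4 * (L + rho + delta) ^+ 2 / delta * p%:R.

(* When the denominator vanishes the quotient is read as +oo, so the minimum
   is 1 (whereas x / 0 = 0 in the library). *)
Definition alpha_bar (sigma Lh M1 M2 : R) : R :=
  let c := rho * M2 + 1 / 2 * L * M1 ^+ 2 + Lh * M2 in
  if c == 0 then 1 else Num.min 1 ((2 - sigma) * kappa1 / (2 * c)).

End constants.

Section algorithm.
Context {R : realType} {n r : nat}.

Definition subproblem (f h : 'M[R]_(n, r) -> R) (Xk : 'M[R]_(n, r))
    (Bk : 'M[R]_(n, r) -> 'M[R]_(n, r)) (V : 'M[R]_(n, r)) : R :=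
  fdot (gradient f Xk) V + 1 / 2 * fdot V (Bk V) + h (Xk + V).

(* k - m is truncated subtraction, i.e. max{0, k - m}; the default value
   F (X k) of the iterated maximum belongs to the window. *)
Definition window_max (F : 'M[R]_(n, r) -> R) (m : nat)
    (X : nat -> 'M[R]_(n, r)) (k : nat) : R :=
  \big[Num.max/F (X k)]_((k - m)%N <= j < k.+1) F (X j).

Definition sufficient_decrease (F : 'M[R]_(n, r) -> R)
    (Rt : 'M[R]_(n, r) -> 'M[R]_(n, r) -> 'M[R]_(n, r)) (sigma : R) (m : nat)
    (X V : nat -> 'M[R]_(n, r)) (B : nat -> 'M[R]_(n, r) -> 'M[R]_(n, r))
    (k : nat) (alpha : R) : Prop :=
  F (Rt (X k) (alpha *: V k)) <=
    window_max F m X k - 1 / 2 * sigma * alpha * fdot (V k) (B k (V k)).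

(* X, V, B, N : iterates, search directions, operators and numbers of
   backtracking steps of an infinite run of the algorithm. *)
Record ManPQN_run (f h : 'M[R]_(n, r) -> R)
    (Rt : 'M[R]_(n, r) -> 'M[R]_(n, r) -> 'M[R]_(n, r)) (gamma sigma : R)
    (m : nat) (X V : nat -> 'M[R]_(n, r))
    (B : nat -> 'M[R]_(n, r) -> 'M[R]_(n, r)) (N : nat -> nat) : Prop := {
  run_init : stiefel (X 0%N) ;
  run_spd : forall k, spd_operator_on (tangent (X k)) (B k) ;
  run_direction : forall k,
    is_argmin_on (tangent (X k)) (subproblem f h (X k) (B k)) (V k) ;
  run_linesearch : forall k,
    sufficient_decrease (f \+ h) Rt sigma m X V B k (gamma ^+ N k) ;
  run_linesearch_min : forall k i, (i < N k)%N ->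
    ~ sufficient_decrease (f \+ h) Rt sigma m X V B k (gamma ^+ i) ;
  run_step : forall k, X k.+1 = Rt (X k) (gamma ^+ N k *: V k)
}.

End algorithm.

(* Main.v *)
Require Import Defs.
From HB Require Import structures.
From mathcomp Require Import all_boot all_order all_algebra.
From mathcomp Require Import all_classical all_reals all_analysis.
From mathcomp Require Import ring lra.
Import Order.TTheory GRing.Theory Num.Theory.
Import numFieldNormedType.Exports.
Local Open Scope classical_set_scope.
Local Open Scope ring_scope.

(** Write Q_k for the squared B_k-norm of V_k and F for f + h.

    Comparing the minimiser V_k of the strongly convex subproblem with the
    points t V_k, t -> 1, shows that the model <grad f, V> + h (X_k + V) falls by
    at least Q_k along V_k ([argmin_model_decrease]).  Moving to the retracted
    point R_(X_k) (alpha V_k) instead costs only second-order terms: the descent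
    inequality for f ([descent_lemma]), the convexity and the Lipschitz
    continuity of h, and the two bounds M1, M2 on the retraction give, for
    0 <= alpha <= 1,
      F (R_(X_k) (alpha V_k))
        <= F (X_k) - alpha Q_k + c alpha^2 |V_k|^2,
      c = rho M2 + L M1^2 / 2 + Lh M2
    ([retraction_step_decrease]).  As kappa1 |V_k|^2 <= Q_k, the
    quadratic term is absorbed by (1 - sigma / 2) alpha Q_k as soon as
    alpha <= alpha_bar; the line search therefore accepts every such alpha, and
    backtracking by the factor gamma stops at some alpha_k >= gamma alpha_bar.

    While |V_k| > epsilon, each iteration thus pushes F below its maximum over
    the previous m + 1 iterates by at least
      D = sigma gamma alpha_bar kappa1 epsilon^2 / 2,
    so F loses at least D over every m + 1 consecutive iterations
    ([nonmonotone_decrease]).  With K = ceil ((F (X_0) - Fstar) / D), failure up to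
    iteration (m + 1) K would give F <= F (X_0) - (K + 1) D < Fstar. *)

(** * The Frobenius inner product *)

Section frobenius.
Context {R : realType} {n r : nat}.
Implicit Types (a : R) (A B C : 'M[R]_(n, r)).

Lemma fdotC A B : fdot A B = fdot B A.
Proof. by rewrite /fdot -mxtrace_tr trmx_mul trmxK. Qed.

Lemma fdotDr A B C : fdot A (B + C) = fdot A B + fdot A C.
Proof. by rewrite /fdot mulmxDr mxtraceD. Qed.

Lemma fdotZr a A B : fdot A (a *: B) = a * fdot A B.
Proof. by rewrite /fdot -scalemxAr mxtraceZ. Qed.

Lemma fdotBr A B C : fdot A (B - C) = fdot A B - fdot A C.
Proof. by rewrite fdotDr -scaleN1r fdotZr mulN1r. Qed.

Lemma fdotDl A B C : fdot (A + B) C = fdot A C + fdot B C.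
Proof. by rewrite fdotC fdotDr !(fdotC C). Qed.

Lemma fdotBl A B C : fdot (A - B) C = fdot A C - fdot B C.
Proof. by rewrite fdotC fdotBr !(fdotC C). Qed.

Lemma fdotZl a A B : fdot (a *: A) B = a * fdot A B.
Proof. by rewrite fdotC fdotZr fdotC. Qed.

Lemma fdotE A B : fdot A B = \sum_j \sum_i A i j * B i j.
Proof.
rewrite /fdot /mxtrace; apply: eq_bigr => j _.
by rewrite mxE; apply: eq_bigr => i _; rewrite mxE.
Qed.

Lemma fdot_ge0 A : 0 <= fdot A A.
Proof.
by rewrite fdotE; apply: sumr_ge0 => j _; apply: sumr_ge0 => i _; exact: sqr_ge0.
Qed.

Lemma fnorm_ge0 A : 0 <= fnorm A.
Proof. exact: sqrtr_ge0. Qed.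

Lemma fnorm_sqr A : fnorm A ^+ 2 = fdot A A.
Proof. by rewrite sqr_sqrtr // fdot_ge0. Qed.

Lemma fnormZ a A : 0 <= a -> fnorm (a *: A) = a * fnorm A.
Proof.
move=> a0; rewrite /fnorm fdotZl fdotZr mulrA -expr2 sqrtrM ?sqr_ge0 //.
by rewrite sqrtr_sqr ger0_norm.
Qed.

(** Cauchy-Schwarz: t |-> |A - t B|^2 is nonnegative, in particular at its
    minimiser A.B / |B|^2.  If |B| = 0 it is affine in t, and a positive slope
    coefficient A.B would make it negative for large t. *)
Lemma fdot_le_fnorm A B : fdot A B <= fnorm A * fnorm B.
Proof.
have nA := fnorm_ge0 A; have nB := fnorm_ge0 B.
have [//|ltAB] := leP (fdot A B) (fnorm A * fnorm B).
have AB0 : 0 < fdot A B by apply: le_lt_trans ltAB; exact: mulr_ge0.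
have q t : 0 <= fnorm A ^+ 2 - 2 * t * fdot A B + t ^+ 2 * fnorm B ^+ 2.
  have := fdot_ge0 (A - t *: B).
  rewrite fdotBl !fdotBr !fdotZl !fdotZr (fdotC B A) -!fnorm_sqr; lra.
have [B0|B0] := eqVneq (fnorm B) 0.
  (* This t brings the affine function down to -1. *)
  have := q ((fnorm A ^+ 2 + 1) / (2 * fdot A B)).
  have -> : 2 * ((fnorm A ^+ 2 + 1) / (2 * fdot A B)) * fdot A B
            = fnorm A ^+ 2 + 1 by field; rewrite gt_eqF.
  rewrite B0 expr0n /= mulr0; lra.
have := q (fdot A B / fnorm B ^+ 2).
have -> : fnorm A ^+ 2 - 2 * (fdot A B / fnorm B ^+ 2) * fdot A B
   + (fdot A B / fnorm B ^+ 2) ^+ 2 * fnorm B ^+ 2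
   = ((fnorm A * fnorm B) ^+ 2 - fdot A B ^+ 2) / fnorm B ^+ 2 by field.
have ? : 0 < fnorm B by rewrite lt_neqAle eq_sym B0.
rewrite pmulr_lge0 ?invr_gt0 ?exprn_gt0 //.
have : (fnorm A * fnorm B) ^+ 2 < fdot A B ^+ 2.
  by rewrite ltr_sqr // ?nnegrE ?mulr_ge0 // ltW.
lra.
Qed.

Lemma fnormD A B : fnorm (A + B) <= fnorm A + fnorm B.
Proof.
rewrite -ler_sqr ?nnegrE ?addr_ge0 ?fnorm_ge0 // fnorm_sqr.
rewrite fdotDl !fdotDr (fdotC B A) -!fnorm_sqr.
have := fdot_le_fnorm A B; lra.
Qed.

Lemma fnormN A : fnorm (- A) = fnorm A.
Proof. by rewrite /fnorm -scaleN1r fdotZl fdotZr mulrA mulrNN !mul1r. Qed.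

Lemma fnorm_stiefel A : stiefel A -> fnorm A = Num.sqrt r%:R.
Proof. by rewrite /stiefel /= /fnorm /fdot => ->; rewrite mxtrace1. Qed.

Lemma tangentZ A B a : tangent A B -> tangent A (a *: B).
Proof.
rewrite /tangent /= linearZ /= -scalemxAl -scalemxAr -scalerDr => ->.
by rewrite scaler0.
Qed.

Lemma tangent0 A : tangent A 0.
Proof. by rewrite /tangent /= trmx0 mul0mx mulmx0 addr0. Qed.

End frobenius.

(** * Descent along a Lipschitz gradient *)

Section smooth_part.
Context {R : realType} {n r : nat}.
Variables (f : 'M[R]_(n, r) -> R) (L : R).
Hypothesis f_diff : forall Y, differentiable f Y.
Hypothesis grad_lip : forall Y Z,
  fnorm (gradient f Y - gradient f Z) <= L * fnorm (Y - Z).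

Lemma gradientE Y D : 'd f Y D = fdot (gradient f Y) D.
Proof.
rewrite [D in LHS]matrix_sum_delta linear_sum fdotE exchange_big.
apply: eq_bigr => i _; rewrite linear_sum; apply: eq_bigr => j _.
by rewrite linearZ /= mxE mulrC.
Qed.

(** The difference quotients of f along the line through Y are literally those
    of the one-variable function. *)
Lemma is_derive_line Y D (t : R) :
  is_derive t 1 (fun s : R => f (Y + s *: D)) (fdot (gradient f (Y + t *: D)) D).
Proof.
have E : (fun k : R => k^-1 *: (f (Y + (k *: 1 + t) *: D) - f (Y + t *: D)))
    = (fun k : R => k^-1 *: (f (k *: D + (Y + t *: D)) - f (Y + t *: D))).
  by apply/funext => k; rewrite scalerDl scaler1 addrCA.
apply: DeriveDef.
  rewrite /derivable /= [X in X @ _]E.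
  exact: (diff_derivable (f_diff (Y + t *: D))).
rewrite /derive [X in X @ _]E -gradientE.
exact: (deriveE (f := f) (a := Y + t *: D) D (f_diff _)).
Qed.

(** The mean value theorem is applied to the restriction of f to the segment
    from Y to Z minus the claimed quadratic upper bound: its derivative is
    nonpositive by the Lipschitz condition and Cauchy-Schwarz. *)
Lemma descent_lemma Y Z :
  f Z <= f Y + fdot (gradient f Y) (Z - Y) + L / 2 * fnorm (Z - Y) ^+ 2.
Proof.
set D := Z - Y.
pose c1 := fdot (gradient f Y) D; pose c2 := L / 2 * fnorm D ^+ 2.
pose psi (t : R) := f (Y + t *: D) - t * c1 - t ^+ 2 * c2.
pose dpsi (t : R) := fdot (gradient f (Y + t *: D)) D - c1 - (2 * t) * c2.
have dpsiP (t : R) : is_derive t (1 : R) psi (dpsi t).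
  have h1 := is_derive_line Y D t.
  have h2 : is_derive t (1 : R) (fun s : R => s * c1) c1.
    by apply: is_derive_eq; rewrite /GRing.scale /= mulr0 add0r mulr1.
  have h3 : is_derive t (1 : R) (fun s : R => s ^+ 2 * c2) (2 * t * c2).
    by apply: is_derive_eq; rewrite /GRing.scale /= mulr0 add0r; ring.
  exact: (is_deriveB (is_deriveB h1 h2) h3).
have cpsi : {within `[0, 1], continuous psi}.
  apply: derivable_within_continuous => t _.
  exact: (@ex_derive _ _ _ _ _ _ _ (dpsiP t)).
have [c /[!in_itv]/= /andP[c0 c1'] eqc] := MVT ltr01 (fun t _ => dpsiP t) cpsi.
have dle0 : dpsi c <= 0.
  have nD : fnorm (Y + c *: D - Y) = c * fnorm D.
    by rewrite addrC addKr fnormZ // ltW.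
  have g1 : fnorm (gradient f (Y + c *: D) - gradient f Y) <= L * (c * fnorm D).
    by rewrite -nD; exact: grad_lip.
  (* Gradients are abstracted: only their distance matters here. *)
  suff CS G G' : fnorm (G' - G) <= L * (c * fnorm D) ->
      fdot G' D - fdot G D - (2 * c) * (L / 2 * fnorm D ^+ 2) <= 0 by exact: CS g1.
  move=> /(ler_wpM2r (fnorm_ge0 D)) /(le_trans (fdot_le_fnorm _ _)).
  rewrite fdotBl; lra.
move: eqc; rewrite /psi scale0r scale1r addr0 {1}/D addrCA subrr addr0 -/D -/c1 -/c2.
lra.
Qed.

(** The supremum is a genuine one, not the default value of an unbounded set:
    the Stiefel manifold lies on the sphere of radius sqrt r, and a Lipschitz
    gradient is bounded on bounded sets. *)
Lemma gradient_le_sup Y : 0 <= L -> stiefel Y ->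
  fnorm (gradient f Y) <= sup_gradient f.
Proof.
move=> L0 SY; apply: ub_le_sup; last by exists Y.
exists (fnorm (gradient f Y) + L * (Num.sqrt r%:R + Num.sqrt r%:R)) => _ [Z SZ <-].
have -> : gradient f Z = gradient f Y + (gradient f Z - gradient f Y).
  by rewrite addrC subrK.
apply: (le_trans (fnormD _ _)); rewrite lerD2l.
apply: (le_trans (grad_lip _ _)); apply: ler_wpM2l => //.
by rewrite (le_trans (fnormD _ _)) // fnormN !fnorm_stiefel.
Qed.

End smooth_part.

(** * The search direction *)

Lemma segment_point {R : pzRingType} {W : lmodType R} (x v : W) (t : R) :
  x + t *: v = t *: (x + v) + (1 - t) *: x.
Proof. by rewrite scalerDr scalerBl scale1r [RHS]addrC addrA subrK. Qed.

Lemma convex_function_le {R : realType} {n r : nat} (h : 'M[R]_(n, r) -> R)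
    (t : R) Y Z :
  convex_function setT h -> 0 <= t -> t <= 1 ->
  h (t *: Y + (1 - t) *: Z) <= t * h Y + (1 - t) * h Z.
Proof.
move=> h_convex t0 t1.
have tt x : x \in [set: 'M[R]_(n, r)] by rewrite inE.
exact: (h_convex (Itv01 t0 t1) Y Z (tt _) (tt _)).
Qed.

Section search_direction.
Context {R : realType} {n r : nat}.
Variables (f h : 'M[R]_(n, r) -> R) (X V : 'M[R]_(n, r)).
Variable (B : 'M[R]_(n, r) -> 'M[R]_(n, r)).
Hypothesis h_convex : convex_function setT h.
Hypothesis B_spd : spd_operator_on (tangent X) B.
Hypothesis V_argmin : is_argmin_on (tangent X) (subproblem f h X B) V.

Lemma spd_operatorZ (t : R) : B (t *: V) = t *: B V.
Proof.
have [_ Blin _ _] := B_spd; have [TV _] := V_argmin.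
have B0 : B 0 = 0.
  have := Blin 1 0 0 (tangent0 X) (tangent0 X).
  by rewrite scaler0 addr0 scale1r => /esym/eqP; rewrite -subr_eq0 addrK => /eqP.
by rewrite -[t *: V]addr0 (Blin t V 0 TV (tangent0 X)) B0 addr0.
Qed.

(** Convexity of h and minimality of V against (1 - s) V yield
    s (<grad f, V> + h (X + V) - h X + Q - s Q / 2) <= 0 for all s in (0, 1],
    where Q is the squared B-norm of V; dividing by s and letting s -> 0 gives the
    claim.  The limit is replaced by one well-chosen s. *)
Lemma argmin_model_decrease :
  fdot (gradient f X) V + h (X + V) - h X <= - fdot V (B V).
Proof.
have [TV Vmin] := V_argmin.
set G := fdot _ V; set Q := fdot V (B V).
have Q0 : 0 <= Q.
  have [_ _ _ Bpos] := B_spd; have [V0|V0] := eqVneq V 0.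
    by rewrite /Q V0 /fdot trmx0 mul0mx mxtrace0.
  exact: ltW (Bpos V TV V0).
pose A := G + h (X + V) - h X + Q.
have [|A0] := leP A 0; first by rewrite /A; lra.
(* Any s in (0, 1] with s Q < 2 A contradicts the minimality of V. *)
pose s := A / (Q + A).
have sQA : s * (Q + A) = A by rewrite /s mulfVK // gt_eqF //; lra.
have s0 : 0 < s by rewrite divr_gt0 //; lra.
have s1 : s <= 1 by rewrite ler_pdivrMr; lra.
have := Vmin ((1 - s) *: V) (tangentZ _ _ _ TV).
rewrite /subproblem spd_operatorZ fdotZl !fdotZr -/G -/Q.
rewrite (segment_point X V (1 - s)).
have := convex_function_le h (1 - s) (X + V) X h_convex.
rewrite subr_ge0 => /(_ s1) /(_ ltac:(lra)) c1 c2.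
have : s * (A - s * Q / 2) <= 0 by rewrite /A; lra.
rewrite pmulr_rle0 // => c3.
have : 0 < s * A by exact: mulr_gt0.
lra.
Qed.

Variables (L Lh rho M1 M2 alpha : R) (Y : 'M[R]_(n, r)).
Hypothesis f_diff : forall Z, differentiable f Z.
Hypothesis L_ge0 : 0 <= L.
Hypothesis grad_lip : forall Z Z',
  fnorm (gradient f Z - gradient f Z') <= L * fnorm (Z - Z').
Hypothesis Lh_ge0 : 0 <= Lh.
Hypothesis h_lip : forall Z Z', `|h Z - h Z'| <= Lh * fnorm (Z - Z').
Hypothesis grad_le : fnorm (gradient f X) <= rho.
Hypothesis alpha_ge0 : 0 <= alpha.
Hypothesis alpha_le1 : alpha <= 1.
Hypothesis Y_M1 : fnorm (Y - X) <= M1 * fnorm (alpha *: V).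
Hypothesis Y_M2 : fnorm (Y - X - alpha *: V) <= M2 * fnorm (alpha *: V) ^+ 2.

(** The retracted point Y is compared with X + alpha V: their distance is of order
    alpha^2 |V|^2, which f feels through its gradient and h through its Lipschitz
    constant, while convexity of h turns the step alpha V into a fraction alpha
    of the model decrease along V. *)
Lemma retraction_step_decrease :
  f Y + h Y <= f X + h X - alpha * fdot V (B V)
    + (rho * M2 + 1 / 2 * L * M1 ^+ 2 + Lh * M2) * (alpha * fnorm V) ^+ 2.
Proof.
move: Y_M1 Y_M2; rewrite fnormZ //; set w := alpha * fnorm V => y1 y2.
set e := Y - X - alpha *: V in y2.
have e0 := fnorm_ge0 e; have g0 := fnorm_ge0 (gradient f X).
have fY := descent_lemma f L f_diff grad_lip X Y.
have gY : fdot (gradient f X) (Y - X)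
    <= alpha * fdot (gradient f X) V + rho * (M2 * w ^+ 2).
  rewrite -[Y - X](subrK (alpha *: V)) -/e fdotDr fdotZr addrC lerD2l.
  apply: (le_trans (fdot_le_fnorm _ _)); exact: ler_pM.
have qY : L / 2 * fnorm (Y - X) ^+ 2 <= L / 2 * (M1 * w) ^+ 2.
  apply: ler_wpM2l; first exact: divr_ge0.
  by rewrite ler_sqr ?nnegrE ?fnorm_ge0 // (le_trans (fnorm_ge0 _) y1).
have hY : h Y - h (X + alpha *: V) <= Lh * (M2 * w ^+ 2).
  apply: (le_trans (ler_norm _)); apply: (le_trans (h_lip _ _)).
  by rewrite opprD addrA; exact: ler_wpM2l.
have hc : h (X + alpha *: V) <= alpha * h (X + V) + (1 - alpha) * h X.
  rewrite (segment_point X V alpha).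
  exact: convex_function_le.
have opt := ler_wpM2l alpha_ge0 argmin_model_decrease.
lra.
Qed.

End search_direction.

(** * Nonmonotone decrease *)

(** Index k + 1 lies in block k / (m + 1) of length m + 1.  The window of k only
    reaches back m + 1 places from k + 1, hence at most one block, so each block
    loses a further D. *)
Lemma nonmonotone_decrease {R : realType} (a : nat -> R) (m K : nat) (D : R) :
  0 <= D ->
  (forall k, (k <= K)%N ->
    a k.+1 <= \big[Num.max/a k]_((k - m)%N <= j < k.+1) a j - D) ->
  forall k, (k <= K)%N -> a k.+1 <= a 0%N - (k %/ m.+1).+1%:R * D.
Proof.
move=> D0 step; elim/ltn_ind => k IH leK.
have past j : (k - m <= j <= k)%N -> a j <= a 0%N - (k %/ m.+1)%:R * D.
  case: j => [|j] /andP[].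
    by rewrite leqn0 subn_eq0 => km _; rewrite divn_small // mul0r subr0.
  rewrite leq_subLR => kj jk; apply: (le_trans (IH j jk (ltnW (leq_trans jk leK)))).
  rewrite lerD2l lerN2 ler_wpM2r // ler_nat.
  apply: (leq_trans (leq_div2r m.+1 kj)).
  by rewrite -addSnnS divnDl ?dvdnn // divnn.
apply: (le_trans (step k leK)); rewrite -natr1 mulrDl mul1r opprD addrA lerD2r.
rewrite big_nat; apply: bigmax_le => [|j]; last by rewrite ltnS; exact: past.
by apply: past; rewrite leq_subr leqnn.
Qed.

(** * The constants *)

(** Here upsilon >= 5, so the geometric-sum quotient has no zero denominator and
    both summands are nonnegative. *)
Lemma kappa1_gt0 {R : realType} (L rho delta : R) (p : nat) :
  0 <= L -> 0 <= rho -> 0 < delta -> 0 < kappa1 L rho delta p.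
Proof.
move=> L0 rho0 delta0; rewrite invr_gt0.
set u := upsilon L rho delta.
have u1 : 1 <= u by rewrite ler_pdivlMr //; lra.
have u2 : 1 <= u ^+ (2 * p) by exact: exprn_ege1.
have u3 : 1 <= u ^+ 2 by exact: exprn_ege1.
apply: ltr_wpDl; last by rewrite divr_gt0 //; lra.
apply: mulr_ge0; last by rewrite divr_ge0 // ltW.
by rewrite divr_ge0 ?subr_ge0.
Qed.

Section step_size_threshold.
Context {R : realType}.
Variables (L rho delta sigma Lh M1 M2 : R) (p : nat).
Let c := rho * M2 + 1 / 2 * L * M1 ^+ 2 + Lh * M2.
Let k1 := kappa1 L rho delta p.
Let abar := alpha_bar L rho delta p sigma Lh M1 M2.
Hypothesis c_ge0 : 0 <= c.
Hypothesis k1_gt0 : 0 < k1.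
Hypothesis sigma_lt2 : sigma < 2.

Lemma alpha_bar_gt0 : 0 < abar.
Proof.
rewrite /abar /alpha_bar -/c -/k1; case: eqVneq => // c0.
rewrite lt_min ltr01 divr_gt0 ?mulr_gt0 ?subr_gt0 //.
by rewrite lt_neqAle eq_sym c0.
Qed.

Lemma alpha_bar_le1 : abar <= 1.
Proof.
by rewrite /abar /alpha_bar; case: ifP => // _; rewrite ge_min lexx.
Qed.

(** This is the condition under which the second-order error of a step is
    absorbed by the part 1 - sigma / 2 of the model decrease. *)
Lemma alpha_bar_le (alpha : R) :
  alpha <= abar -> c * alpha <= (1 - sigma / 2) * k1.
Proof.
rewrite /abar /alpha_bar -/c -/k1; case: eqVneq => [-> _|c0].
  by rewrite mul0r mulr_ge0 ?(ltW k1_gt0) // subr_ge0 ler_pdivrMr // mul1r ltW.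
rewrite le_min => /andP[_]; rewrite ler_pdivlMr; first by move=> ?; lra.
by rewrite mulr_gt0 // lt_neqAle eq_sym c0.
Qed.

End step_size_threshold.

(** * Iteration complexity *)

Theorem corollary4p1 (R : realType) (n r : nat)
    (f h : 'M[R]_(n, r) -> R) (L Lh : R)
    (Rt : 'M[R]_(n, r) -> 'M[R]_(n, r) -> 'M[R]_(n, r)) (M1 M2 : R)
    (gamma sigma delta : R) (m p : nat)
    (X V : nat -> 'M[R]_(n, r)) (B : nat -> 'M[R]_(n, r) -> 'M[R]_(n, r))
    (Nls : nat -> nat) (Fstar epsilon : R)
    (rho := sup_gradient f)
    (k1 := kappa1 L rho delta p) (k2 := kappa2 L rho delta p)
    (abar := alpha_bar L rho delta p sigma Lh M1 M2)
    (f_C1 : is_Ck 1 setT f)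
    (L_ge0 : 0 <= L)
    (grad_lip : forall Y Z,
      fnorm (gradient f Y - gradient f Z) <= L * fnorm (Y - Z))
    (h_convex : convex_function setT h)
    (Lh_ge0 : 0 <= Lh)
    (h_lip : forall Y Z, `|h Y - h Z| <= Lh * fnorm (Y - Z))
    (Rt_retraction : is_retraction Rt)
    (M1_gt0 : 0 < M1) (M2_gt0 : 0 < M2)
    (Rt_M1 : forall Y xi, stiefel Y -> tangent Y xi ->
      fnorm (Rt Y xi - Y) <= M1 * fnorm xi)
    (Rt_M2 : forall Y xi, stiefel Y -> tangent Y xi ->
      fnorm (Rt Y xi - Y - xi) <= M2 * fnorm xi ^+ 2)
    (gamma_gt0 : 0 < gamma) (gamma_lt1 : gamma < 1)
    (sigma_gt0 : 0 < sigma) (sigma_lt1 : sigma < 1)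
    (m_gt0 : (0 < m)%N)
    (delta_gt0 : 0 < delta) (p_gt0 : (0 < p)%N)
    (run : ManPQN_run f h Rt gamma sigma m X V B Nls)
    (B_bounds : forall k W, tangent (X k) W ->
      k1 * fnorm W ^+ 2 <= fdot W (B k W) <= k2 * fnorm W ^+ 2)
    (Fstar_min : is_min_on (@stiefel R n r) (f \+ h) Fstar)
    (epsilon_gt0 : 0 < epsilon) :
  exists k : nat,
    k%:Z <= m.+1%:Z * Num.ceil (2 * ((f \+ h) (X 0%N) - Fstar) /
                               (sigma * k1 * gamma * abar * epsilon ^+ 2))
    /\ fnorm (V k) <= epsilon.
Proof.
have f_diff Y : differentiable f Y by exact: (f_C1.1 Y I).
have [init spd dir ls lsmin stp] := run.
have SX k : stiefel (X k).
  elim: k => // k SXk; rewrite stp; case: Rt_retraction => RtS _ _ _.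
  by apply: RtS => //; apply: tangentZ; case: (dir k).
have grad_le k : fnorm (gradient f (X k)) <= rho.
  exact: (gradient_le_sup f L grad_lip (X k) L_ge0 (SX k)).
have rho0 : 0 <= rho := le_trans (fnorm_ge0 _) (grad_le 0%N).
pose c := rho * M2 + 1 / 2 * L * M1 ^+ 2 + Lh * M2.
have c0 : 0 <= c.
  by rewrite !addr_ge0 ?mulr_ge0 ?sqr_ge0 // ltW.
have k10 : 0 < k1 by exact: kappa1_gt0.
have sigma2 : sigma < 2 by lra.
have abar0 : 0 < abar by exact: alpha_bar_gt0.
have abar1 : abar <= 1 by exact: alpha_bar_le1.
have accept k alpha : 0 <= alpha -> alpha <= abar ->
    sufficient_decrease (f \+ h) Rt sigma m X V B k alpha.
  move=> a0 ab; have TV := (dir k).1.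
  have TaV : tangent (X k) (alpha *: V k) by exact: tangentZ.
  have := retraction_step_decrease f h (X k) (V k) (B k) h_convex (spd k) (dir k)
    L Lh rho M1 M2 alpha (Rt (X k) (alpha *: V k)) f_diff L_ge0 grad_lip Lh_ge0
    h_lip (grad_le k) a0 (le_trans ab abar1) (Rt_M1 _ _ (SX k) TaV)
    (Rt_M2 _ _ (SX k) TaV).
  have ca := alpha_bar_le L rho delta sigma Lh M1 M2 p c0 k10 sigma2 alpha ab.
  have /andP[kV _] := B_bounds k (V k) TV.
  have Fw : (f \+ h) (X k) <= window_max (f \+ h) m X k by exact: bigmax_ge_id.
  rewrite /sufficient_decrease -/c -/k1 in ca *.
  move: kV Fw ca => /=; move: (fdot _ _) (fnorm _) => Q w kV Fw ca step.
  have := ler_wpM2r (mulr_ge0 a0 (sqr_ge0 w)) ca.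
  have := ler_wpM2l (mulr_ge0 a0 (ltW (_ : 0 < 1 - sigma / 2))) kV.
  move=> /(_ ltac:(lra)) q1 q2; lra.
(* A rejected step gamma^i exceeds alpha_bar, and the accepted one is at most one
   factor gamma smaller. *)
have step_ge k : gamma * abar <= gamma ^+ Nls k.
  case E : (Nls k) => [|i].
    by rewrite expr0 mulr_ile1 // ltW.
  rewrite exprS ler_pM2l //; have [//|lt_ab] := leP abar (gamma ^+ i).
  case: (lsmin k i); first by rewrite E.
  by apply: accept; [exact: exprn_ge0 (ltW gamma_gt0)|exact: ltW].
pose Delta := (f \+ h) (X 0%N) - Fstar.
have Delta0 : 0 <= Delta by rewrite subr_ge0; exact: (Fstar_min.2 _ init).
pose D := 1 / 2 * sigma * (gamma * abar) * (k1 * epsilon ^+ 2).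
have D0 : 0 < D by rewrite !mulr_gt0 ?exprn_gt0 ?divr_gt0.
pose q := 2 * Delta / (sigma * k1 * gamma * abar * epsilon ^+ 2).
have qE : q * D = Delta.
  by rewrite /q /D; field; rewrite !gt_eqF.
have q0 : 0 <= q by rewrite -(pmulr_lge0 _ D0) qE.
rewrite -/Delta -/q.
have [K KE] : exists K : nat, Num.ceil q = K%:Z.
  by exists `|Num.ceil q|%N; rewrite gez0_abs // ceil_ge0; lra.
apply: contrapT => nstat.
have big k : (k <= m.+1 * K)%N -> epsilon < fnorm (V k).
  move=> kK; rewrite ltNge; apply/negP => small; apply: nstat; exists k.
  by rewrite KE -PoszM lez_nat.
have decr k : (k <= m.+1 * K)%N ->
    (f \+ h) (X k.+1) <= window_max (f \+ h) m X k - D.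
  move=> kK; rewrite stp; apply: (le_trans (ls k)); rewrite lerD2l lerN2.
  have /andP[kV _] := B_bounds k (V k) (dir k).1.
  apply: ler_pM; [by rewrite !mulr_ge0 // ltW|by rewrite mulr_ge0 ?sqr_ge0 // ltW| |].
    by rewrite ler_wpM2l // mulr_ge0 // ltW.
  apply: le_trans kV; rewrite ler_wpM2l ?(ltW k10) //.
  by rewrite ler_sqr ?nnegrE ?fnorm_ge0 // ltW // big.
have := nonmonotone_decrease (fun k => (f \+ h) (X k)) m _ D (ltW D0) decr
  (m.+1 * K)%N (leqnn _).
rewrite mulKn // -natr1 => low.
have := Fstar_min.2 _ (SX (m.+1 * K).+1); rewrite leNgt => /negP; apply.
apply: (le_lt_trans low); rewrite ltrBlDr -ltrBlDl -/Delta -qE ltr_pM2r //.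
have := ceil_ge q; rewrite KE -pmulrn; lra.
Qed.
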